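(* Let $G$ be a locally compact second countable unimodular group with Haar measure $\lambda$. Let $\{F_n\}_{n\in\mathbb{N}}$ be a family of symmetric compact subsets of $G$ of positive Haar measure, each containing the group identity. Let $N:\mathbb{N}\to\mathbb{N}$ be an increasing function with $N(2)>2$, and define $E_1=F_1$ and $$E_n=\left(E_{n-1}^{N(n)-2}\right)^{-1}F_n\left(E_{n-1}^{N(n)-2}\right)^{-1}\quad\text{for } n\ge2.$$ Let $t_n\in(0,1)$, $n\in\mathbb{N}$, with $\sum_{n\in\mathbb{N}}t_n=1$, and let $\omega$ be the probability measure on $G$ with $$\frac{d\omega}{d\lambda}=\sum_{n\in\mathbb{N}}t_n\frac{\chi_{E_n}}{\lambda(E_n)}.$$ Set $r_n=\sum_{j=n}^\infty t_j$. If $t_n$ and $N(n)$ are chosen such that $\lim_{n\to\infty}r_nN(n)$ exists and lies in $(0,+\infty)$ and $\lim_{n\to\infty}\frac{r_{n+1}}{r_n}$ exists and lies in $(0,1)$, then there exists a constant $C'>0$ such that, $\lambda$-almost everywhere on $G$, $$\liminf_{n\to\infty}\frac{\lambda(F_n)}{N(n)}\sum_{j=0}^{N(n)-1}\frac{d\omega^{(j)}}{d\lambda}\;\ge\;C'\left(\liminf_{n\to\infty}\frac{\lambda(F_n)}{\lambda(E_n)}\chi_{F_n}\right).$$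
   Context: $\mathbb{N}=\{1,2,\dots\}$. For subsets $A,B\subset G$, $AB=\{ab: a\in A,b\in B\}$, $A^k$ is the $k$-fold product set, $A^{-1}=\{a^{-1}:a\in A\}$, and $A$ is symmetric if $A=A^{-1}$. $\chi_A$ is the indicator function of $A$. The convolution of finite Borel measures is $(\mu*\nu)(E)=\int_G\int_G 1_E(gh)\,d\mu(g)\,d\nu(h)$; $\omega^{(j)}$ is the $j$-fold convolution of $\omega$ with itself, and $\omega^{(0)}=\delta_e$ (for $j=0$, $\frac{d\omega^{(0)}}{d\lambda}$ means the density of the absolutely continuous part of $\delta_e$, i.e. it is $0$ if $G$ is not discrete). The liminf's of functions on $G$ are pointwise. *)

(* Defs.v *)
From HB Require Import structures.
From mathcomp Require Import all_boot all_order all_algebra.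
From mathcomp Require Import all_classical all_reals all_analysis measurable_realfun.

Set Implicit Arguments.
Unset Strict Implicit.
Unset Printing Implicit Defensive.

Import Order.TTheory GRing.Theory Num.Theory.
Import numFieldNormedType.Exports.

Local Open Scope classical_set_scope.
Local Open Scope ring_scope.

(* The library's topological groups are additive; this is the multiplicative
   version, on top of MathComp's groupType.  The distinguished point is only
   there because measurableType requires one. *)
HB.mixin Record isTopologicalGroup G
    of PointedTopological G & Group G := {
  mulg_continuous : continuous (fun x : G * G => (x.1 * x.2)%g) ;
  invg_continuous : continuous (fun x : G => (x^-1)%g)
}.

#[short(type="topologicalGroupType")]
HB.structure Definition TopologicalGroup :=
  {G of PointedTopological G & Group G & isTopologicalGroup G}.

Notation borel G := (g_sigma_algebraType (@open G)).

Section product_sets.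
Variable G : topologicalGroupType.
Implicit Types A B : set G.

Definition mulset A B : set G := [set (a * b)%g | a in A & b in B].

Definition invset A : set G := [set (a^-1)%g | a in A].

Fixpoint powset A (k : nat) : set G :=
  if k is k'.+1 then mulset A (powset A k') else [set 1%g].

Definition symmetric_set A := A = invset A.

End product_sets.

Section haar.
Variables (R : realType) (G : topologicalGroupType).
Implicit Type mu : {measure set (borel G) -> \bar R}.
Local Open Scope ereal_scope.

Definition left_invariant mu := forall (g : G) (A : set (borel G)),
  measurable A -> mu (mulset [set g] A) = mu A.

Definition right_invariant mu := forall (g : G) (A : set (borel G)),
  measurable A -> mu (mulset A [set g]) = mu A.

Definition radon mu :=
  [/\ forall K : set G, compact K -> mu K < +oo,
      forall A : set (borel G), measurable A ->
        mu A = ereal_inf [set mu U | U in [set U : set G | open U /\ A `<=` U]]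
    & forall U : set G, open U ->
        mu U =
        ereal_sup [set mu K | K in [set K : set G | compact K /\ K `<=` U]]].

Definition haar_measure mu :=
  [/\ mu setT != 0, radon mu & left_invariant mu].

End haar.

Definition unimodular (R : realType) (G : topologicalGroupType) :=
  forall mu : {measure set (borel G) -> \bar R},
    haar_measure mu -> right_invariant mu.

Section convolution.
Variables (R : realType) (G : topologicalGroupType).
Implicit Types mu nu : set (borel G) -> \bar R.
Local Open Scope ereal_scope.

Definition convolution mu nu : set (borel G) -> \bar R := fun A =>
  \int[nu]_(h in setT) \int[mu]_(g in setT) (\1_A (g * h)%g)%:E.

Fixpoint convolution_pow mu (j : nat) : set (borel G) -> \bar R :=
  if j is j'.+1 then convolution (convolution_pow mu j') mu
  else \d_(1%g : borel G).

End convolution.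

Section densities.
Variables (R : realType) (d : measure_display) (T : measurableType d).
Variable lambda : {measure set T -> \bar R}.
Implicit Types (nu : set T -> \bar R) (f : T -> \bar R).
Local Open Scope ereal_scope.

Definition has_density nu f :=
  [/\ measurable_fun setT f, forall x, 0 <= f x
    & forall A, measurable A -> nu A = \int[lambda]_(x in A) f x].

Definition mutually_singular (nu : {measure set T -> \bar R}) :=
  exists S : set T, [/\ measurable S, lambda S = 0 & nu (~` S) = 0].

(* f is a version of d nu / d lambda, read as the density of the absolutely
   continuous part of nu in its Lebesgue decomposition.  When nu is itself
   absolutely continuous the singular part vanishes. *)
Definition is_rn_derivative nu f :=
  exists nu_a nu_s : {measure set T -> \bar R},
    [/\ forall A, measurable A -> nu A = nu_a A + nu_s A,
        has_density nu_a f & mutually_singular nu_s].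

End densities.

(* Main.v *)
From HB Require Import structures.
Require Import Defs.
From mathcomp Require Import all_boot all_order all_algebra.
From mathcomp Require Import all_classical all_reals all_analysis measurable_realfun.
From mathcomp Require Import ring lra zify.

(** The idea is to look at a walk of j steps with law omega in which exactly
    one step is a uniform step in E_n and all the others come from the earlier
    sets.  These are nested, so the other steps all lie in E_(n-1).  If the
    large step is h and j < N(n), the position of the walk is a h b, where a
    and b lie in P = E_(n-1)^(N(n)-2); since E_n = P^-1 F_n P^-1, the uniform
    law on E_n translated by a and b still has density 1 / lambda(E_n) on all
    of F_n, by left and right invariance.  The large step can occur at any of
    the j places, and each other step is drawn from E_1, ..., E_(n-1) with
    probability 1 - r_n.  Hence, on F_n,

      d omega^(j) / d lambda >= j t_n (1 - r_n)^(j-1) / lambda(E_n).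

    Summing over j < N(n), and using t_n ~ (1 - q) r_n and r_n N(n) -> c, the
    factor t_n / N(n) * sum_j j (1 - r_n)^(j-1) stays above a positive
    constant, which is C'.

    The choice of the place of the large step is never made explicit: the
    bound is proved by induction on j, splitting only the last step
    ([convolution_pow_lower_bound]).  If the last step is small, induction
    applies to a right translate of the target set; if it is the large one,
    Fubini's theorem exchanges it with the first j steps, which stay in
    E_(n-1)^j with probability at least (1 - r_n)^j
    ([convolution_pow_powset]).  Fubini needs the multiplication to be
    measurable for the product of the Borel sigma-algebras, and this is where
    second countability enters ([measurable_mulg]).  The bounds on measures of
    sets become bounds on densities almost everywhere
    ([is_rn_derivative_ge]), and the estimate of the constant is
    [escape_weight_ge]. *)

Set Implicit Arguments.
Unset Strict Implicit.
Unset Printing Implicit Defensive.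

Import Order.TTheory GRing.Theory Num.Theory.
Import numFieldNormedType.Exports.

Local Open Scope classical_set_scope.
Local Open Scope ring_scope.

(** * Product sets in a group *)

Section product_sets.
Variable G : topologicalGroupType.
Implicit Types A B C : set G.

Lemma mulsetP A B a b : A a -> B b -> mulset A B (a * b)%g.
Proof. by move=> Aa Bb; exists a => //; exists b. Qed.

Lemma mulsetA A B C : mulset A (mulset B C) = mulset (mulset A B) C.
Proof.
apply/seteqP; split => [_ [a Aa [_ [b Bb [c Cc <-]] <-]]|].
  by rewrite mulgA; apply: mulsetP => //; exact: mulsetP.
move=> _ [_ [a Aa [b Bb <-]] [c Cc <-]].
by rewrite -mulgA; apply: mulsetP => //; exact: mulsetP.
Qed.

Lemma mulset1g A : mulset [set 1%g] A = A.
Proof.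
apply/seteqP; split => [_ [_ -> [b Bb <-]]|a Aa]; first by rewrite mul1g.
by rewrite -[a]mul1g; exact: mulsetP.
Qed.

Lemma mulsetg1 A : mulset A [set 1%g] = A.
Proof.
apply/seteqP; split => [_ [b Bb [_ -> <-]]|a Aa]; first by rewrite mulg1.
by rewrite -[a]mulg1; exact: mulsetP.
Qed.

(** [powset] grows on the left, whereas the random walk below grows on the
    right. *)
Lemma powsetSr A k : powset A k.+1 = mulset (powset A k) A.
Proof.
elim: k => [|k IH]; first by rewrite /= mulset1g mulsetg1.
by rewrite [RHS]/= -mulsetA -IH.
Qed.

Lemma powset1 A k : A 1%g -> powset A k 1%g.
Proof. by move=> A1; elim: k => //= k IH; rewrite -[1%g]mulg1; exact: mulsetP. Qed.

Lemma powset_le A k l : A 1%g -> (k <= l)%N -> powset A k `<=` powset A l.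
Proof.
move=> A1 /subnK <-; elim: (l - k)%N => // d IH x /IH Ax.
by rewrite -[x]mul1g; exact: mulsetP.
Qed.

Lemma invsetE A : invset A = (fun x => x^-1)%g @^-1` A.
Proof.
apply/seteqP; split => [_ [a Aa <-]|x Ax] /=; first by rewrite invgK.
by exists (x^-1)%g => //; rewrite invgK.
Qed.

Lemma symmetric_setP A : symmetric_set A <-> forall x, A x -> A (x^-1)%g.
Proof.
rewrite /symmetric_set invsetE; split => [{1}-> x|H] //.
by apply/seteqP; split => x /= /H //; rewrite invgK.
Qed.

Lemma invset_mulset A B : invset (mulset A B) = mulset (invset B) (invset A).
Proof.
apply/seteqP; split => [_ [_ [a Aa [b Bb <-]] <-]|].
  by rewrite invgM; apply: mulsetP; [exists b|exists a].
by move=> _ [_ [b Bb <-] [_ [a Aa <-] <-]]; rewrite -invgM; exists (a * b)%g => //; exact: mulsetP.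
Qed.

Lemma symmetric_powset A k : symmetric_set A -> symmetric_set (powset A k).
Proof.
move=> sA; elim: k => [|k IH]; first by apply/symmetric_setP => _ ->; rewrite /= invg1.
by rewrite /symmetric_set powsetSr invset_mulset -sA -IH -powsetSr.
Qed.

Lemma translatelE g A : mulset [set g] A = (fun x => g^-1 * x)%g @^-1` A.
Proof.
apply/seteqP; split => [_ [_ -> [a Aa <-]]|x Ax]; first by rewrite /= mulKg.
by rewrite -[x](mulVKg g); exact: mulsetP.
Qed.

Lemma compact_mulset A B : compact A -> compact B -> compact (mulset A B).
Proof.
move=> cA cB.
have -> : mulset A B = (fun x : G * G => (x.1 * x.2)%g) @` (A `*` B).
  apply/seteqP; split => [_ [a Aa [b Bb <-]]|_ [[a b] [Aa Bb] <-]].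
    by exists (a, b).
  exact: mulsetP.
apply: continuous_compact; last exact: compact_setX.
exact/continuous_subspaceT/mulg_continuous.
Qed.

Lemma compact_powset A k : compact A -> compact (powset A k).
Proof. by move=> cA; elim: k => [|k IH]; [exact: compact_set1|exact: compact_mulset]. Qed.

End product_sets.

(** * Measurability of the multiplication *)

Section borel_mul.
Variable G : topologicalGroupType.

Lemma borel_open (U : set G) : open U -> measurable (U : set (borel G)).
Proof. exact: sub_sigma_algebra. Qed.

Lemma borel_compact (K : set G) : hausdorff_space G -> compact K ->
  measurable (K : set (borel G)).
Proof.
move=> hG /(compact_closed hG) cK; rewrite -[K]setCK; apply: measurableC.
by apply: borel_open; exact: closed_openC.
Qed.

(** The preimage of an open set is open in the product topology, but only the
    rectangles with open sides are known to be measurable; a countable basis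
    writes that preimage as a countable union of such rectangles. *)
Lemma measurable_mulg : @second_countable G ->
  measurable_fun [set: (borel G * borel G)%type]
    (fun x => (x.1 * x.2)%g : borel G).
Proof.
move=> [B cB [oB bB]].
apply: (@measurability _ _ (borel G * borel G)%type (borel G) _ _ (@open G)) => //.
move=> _ [U oU <-]; rewrite setTI.
pose I := [set p : set G * set G | [/\ B p.1, B p.2 &
   forall x y, p.1 x -> p.2 y -> U (x * y)%g]].
rewrite (_ : _ @^-1` U = \bigcup_(p in I) (p.1 `*` p.2)); last first.
  apply/seteqP; split => [[x y] /= Uxy|[x y] [p [_ _ IU]] [/= px py]]; last exact: IU.
  have : nbhs (x, y) ((fun z : G * G => (z.1 * z.2)%g) @^-1` U).
    by apply: mulg_continuous; exact: open_nbhs_nbhs.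
  move=> [[P Q] /= [/bB [V [BV Vx] VP] /bB [W [BW Wy] WQ]] PQU].
  exists (V, W) => //; split => // a b /= Va Wb.
  by apply: (PQU (a, b)); split; [exact: VP|exact: WQ].
rewrite bigcup_set_type; apply: countable_bigcupT_measurable.
  rewrite (eq_countable (card_setT I)).
  by apply: (@sub_countable _ _ _ (B `*` B)); [apply: subset_card_le => p [? ? _]; split|exact: countableX].
move=> j; have [B1 B2 _] := set_mem (valP j).
by apply: measurableX; apply: borel_open; apply: oB.
Qed.

End borel_mul.

(** * Convolution powers are probability measures *)

Section convolution_probability.
Variables (R : realType) (G : topologicalGroupType).
Hypothesis second_countableG : @second_countable G.
Local Open Scope ereal_scope.

Lemma measurable_indic_mul (A : set (borel G)) : measurable A ->
  measurable_fun [set: (borel G * borel G)%type]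
    (fun x => (\1_A (x.1 * x.2)%g)%:E : \bar R).
Proof.
move=> mA; apply/measurable_EFinP.
have mi : measurable_fun setT (\1_A : borel G -> R) by exact: measurable_indic.
exact: (measurableT_comp mi (measurable_mulg second_countableG)).
Qed.

Variables P Q : probability (borel G) R.

Lemma convolution_pushforward A : measurable A ->
  convolution P Q A = pushforward (P \x^ Q) (fun x => (x.1 * x.2)%g : borel G) A.
Proof.
move=> mA; rewrite /convolution /pushforward /product_measure2.
pose M := (fun x : borel G * borel G => (x.1 * x.2)%g : borel G) @^-1` A.
have mM : measurable M.
  by rewrite -[X in measurable X]setTI; exact: (measurable_mulg second_countableG).
apply: eq_integral => h _ /=.
have -> : (fun g => (\1_A (g * h)%g)%:E) = (fun g => (\1_(ysection M h) g)%:E) :> (_ -> \bar R).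
  by apply/funext => g; rewrite !indicE mem_ysection.
by rewrite integral_indic ?setIT//; exact: measurable_ysection.
Qed.

Let convolution0 : convolution P Q set0 = 0.
Proof.
by rewrite convolution_pushforward// /pushforward preimage_set0 measure0.
Qed.

Let convolution_ge0 A : 0 <= convolution P Q A.
Proof.
by apply: integral_ge0 => h _; apply: integral_ge0 => g _; rewrite lee_fin.
Qed.

Let convolution_sigma_additive : semi_sigma_additive (convolution P Q).
Proof.
move=> A mA tA mUA; rewrite convolution_pushforward//.
under eq_fun do under eq_bigr do rewrite convolution_pushforward//.
have mM B : measurable B -> measurable
    ((fun x : borel G * borel G => (x.1 * x.2)%g : borel G) @^-1` B).
  by move=> mB; rewrite -[X in measurable X]setTI; exact: (measurable_mulg second_countableG).
rewrite /pushforward preimage_bigcup; apply: measure_semi_sigma_additive.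
- by move=> n; exact: mM.
- apply/trivIsetP => /= i j _ _ ij; rewrite -preimage_setI.
  by move/trivIsetP : tA => /(_ _ _ _ _ ij) ->//; rewrite preimage_set0.
- by rewrite -preimage_bigcup; exact: mM.
Qed.

HB.instance Definition _ := isMeasure.Build _ _ _ (convolution P Q)
  convolution0 convolution_ge0 convolution_sigma_additive.

Let convolution_setT : convolution P Q setT = 1.
Proof.
rewrite convolution_pushforward// /pushforward preimage_setT.
exact: probability_setT.
Qed.

HB.instance Definition _ := Measure_isProbability.Build _ _ _
  (convolution P Q) convolution_setT.

(** The two sides agree as functions, also on sets that are not measurable, so
    that a convolution can be rewritten into a probability inside the iterated
    integrals that define further convolutions. *)
Lemma convolution_is_probability :
  exists P' : probability (borel G) R, convolution P Q = P' :> (set _ -> _).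
Proof. by exists (convolution P Q). Qed.

End convolution_probability.

Section convolution_pow.
Variables (R : realType) (G : topologicalGroupType).
Hypothesis second_countableG : @second_countable G.

Lemma convolution_pow_probability (omega : probability (borel G) R) j :
  exists P : probability (borel G) R, convolution_pow omega j = P :> (set _ -> _).
Proof.
elim: j => [|j [P /= ->]]; first by exists (\d_(1%g : borel G)).
exact: convolution_is_probability.
Qed.
End convolution_pow.

(** * Integrals of translates *)

Section integral_mrestr.
Context d (T : measurableType d) (R : realType).
Variables (mu : {measure set T -> \bar R}) (D : set T) (mD : measurable D).
Local Open Scope ereal_scope.

Lemma ge0_integral_mrestr (f : T -> \bar R) :
  measurable_fun setT f -> (forall x, 0 <= f x) ->
  \int[mrestr mu mD]_x f x = \int[mu]_(x in D) f x.
Proof.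
move=> mf f0.
rewrite (@ge0_negligible_integral _ _ _ _ setT (~` D))//; last 2 first.
- exact: measurableC.
- by rewrite /= /mrestr setICl measure0.
rewrite setTD setCK; apply: eq_measure_integral => A mA AD.
by rewrite /= /mrestr setIidl.
Qed.
End integral_mrestr.

Section translates.
Variables (R : realType) (G : topologicalGroupType).
Hypothesis second_countableG : @second_countable G.
Implicit Type P : probability (borel G) R.
Local Open Scope ereal_scope.

Lemma measurable_preimage_mull (g : G) (A : set (borel G)) : measurable A ->
  measurable ((fun h : borel G => (g * h)%g : borel G) @^-1` A).
Proof.
have mg : measurable_fun setT (fun h : borel G => (g * h)%g : borel G).
  exact: (@measurable_fun_pair2 _ _ _ (borel G) (borel G) (borel G)
    (fun x => (x.1 * x.2)%g : borel G) g (measurable_mulg second_countableG)).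
by move=> mA; rewrite -[X in measurable X]setTI; exact: mg.
Qed.

Lemma measurable_preimage_mulr (g : G) (A : set (borel G)) : measurable A ->
  measurable ((fun h : borel G => (h * g)%g : borel G) @^-1` A).
Proof.
have mg : measurable_fun setT (fun h : borel G => (h * g)%g : borel G).
  exact: (@measurable_fun_pair1 _ _ _ (borel G) (borel G) (borel G)
    (fun x => (x.1 * x.2)%g : borel G) g (measurable_mulg second_countableG)).
by move=> mA; rewrite -[X in measurable X]setTI; exact: mg.
Qed.

Lemma integral_indic_mulr P (A : set (borel G)) (h : G) : measurable A ->
  \int[P]_g (\1_A (g * h)%g)%:E = P ((fun g => (g * h)%g) @^-1` A).
Proof.
move=> mA; have mAh := measurable_preimage_mulr h mA.
rewrite (_ : (fun g => _) = fun g => (\1_((fun g => (g * h)%g) @^-1` A) g)%:E)//.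
by rewrite integral_indic// setIT.
Qed.

Lemma measurable_integral_indic_mulr P (A : set (borel G)) : measurable A ->
  measurable_fun [set: borel G] (fun h => \int[P]_g (\1_A (g * h)%g)%:E).
Proof.
move=> mA; apply: (measurable_fun_fubini_tonelli_G
  (fun x : borel G * borel G => (\1_A (x.1 * x.2)%g)%:E)) => [|x]; last by rewrite lee_fin.
exact: measurable_indic_mul.
Qed.

Variable lambda : {measure set (borel G) -> \bar R}.

(** A uniform last step: exchanging the integrals, each g in B contributes
    the measure of the left translate of A by the inverse of g, which lies in D
    and has the measure of A.  Restricting lambda to D makes it a finite measure,
    to which Fubini's theorem applies. *)
Lemma integral_indic_mul_ge P (A B D : set (borel G)) :
  measurable A -> measurable B -> measurable D -> lambda D < +oo ->
  left_invariant lambda ->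
  (forall g, B g -> (fun h => (g * h)%g) @^-1` A `<=` D) ->
  P B * lambda A <= \int[lambda]_(h in D) \int[P]_g (\1_A (g * h)%g)%:E.
Proof.
move=> mA mB mD Doo lamL BAD.
have mf : measurable_fun setT
    (fun x : borel G * borel G => (\1_A (x.1 * x.2)%g)%:E : \bar R).
  exact: measurable_indic_mul.
rewrite -(ge0_integral_mrestr _ mD); last 2 first.
- exact: measurable_integral_indic_mulr.
- by move=> h; apply: integral_ge0 => g _; rewrite lee_fin.
have -> : \int[mrestr lambda mD]_h \int[P]_g (\1_A (g * h)%g)%:E =
    \int[P]_g \int[mfrestr mD Doo]_h (\1_A (g * h)%g)%:E.
  rewrite (fubini_tonelli (m2 := mfrestr mD Doo)
    (fun x : borel G * borel G => (\1_A (x.1 * x.2)%g)%:E)) => //.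
have mg : measurable_fun [set: borel G]
    (fun g => \int[mfrestr mD Doo]_h (\1_A (g * h)%g)%:E).
  apply: (measurable_fun_fubini_tonelli_F
    (fun x : borel G * borel G => (\1_A (x.1 * x.2)%g)%:E)) => //.
have g0 g : 0 <= \int[mfrestr mD Doo]_h (\1_A (g * h)%g)%:E.
  by apply: integral_ge0 => h _; rewrite lee_fin.
apply: le_trans (ge0_subset_integral _ mB measurableT mg _ _) => //.
rewrite muleC -integral_cst//; apply: ge0_le_integral => //.
  exact: measurable_funTS.
move=> g Bg /=.
have mgA := measurable_preimage_mull g mA.
rewrite (_ : (fun h => _) = fun h => (\1_((fun h => (g * h)%g) @^-1` A) h)%:E)//.
rewrite integral_indic// setIT /= /mfrestr.
rewrite /mrestr setIidl; last exact: BAD.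
by rewrite -{1}[g]invgK -translatelE lamL.
Qed.

End translates.

(** * Lower bound for the convolution powers *)

Section random_walk_lower_bound.
Variables (R : realType) (G : topologicalGroupType).
Hypotheses (hausdorffG : hausdorff_space G)
  (second_countableG : @second_countable G).
Variables (lambda : {measure set (borel G) -> \bar R})
  (omega : probability (borel G) R).
Hypotheses (lambda_left : left_invariant lambda)
  (lambda_right : right_invariant lambda).
Local Open Scope ereal_scope.

(** This is the inequality omega >= alpha + tau lambda|_E for a measure alpha
    of mass s carried by K, tested against nonnegative functions.  The two parts
    have to be added before comparing with omega, because K and E overlap. *)
Definition step_dominates (K : set G) (s : R) (E : set G) (tau : R) :=
  forall (phi : borel G -> \bar R) (c : R), measurable_fun setT phi ->
    (forall x, 0 <= phi x) -> (0 <= c)%R -> (forall x, K x -> c%:E <= phi x) ->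
  (s * c)%:E + tau%:E * \int[lambda]_(x in E) phi x <= \int[omega]_x phi x.

Variables (K E F : set G) (s tau : R).
Hypotheses (compactK : compact K) (compactE : compact E) (symK : symmetric_set K)
  (oneK : K 1%g) (s_ge0 : (0 <= s)%R) (tau_ge0 : (0 <= tau)%R)
  (omega_dominates : step_dominates K s E tau).

(** A walk all of whose steps lie in K stays in the powers of K. *)
Lemma convolution_pow_powset j :
  (s ^+ j)%:E <= convolution_pow omega j (powset K j).
Proof.
elim: j => [|j IH]; first by rewrite /= diracE mem_set// expr0.
have [P PE] := convolution_pow_probability second_countableG omega j.
have mK i : measurable (powset K i : set (borel G)).
  by apply: borel_compact => //; exact: compact_powset.
rewrite PE in IH; rewrite [convolution_pow _ _]/= PE /convolution.
set A := powset K j.+1; have mA : measurable (A : set (borel G)) by exact: mK.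
have phi0 h : 0 <= \int[P]_g (\1_A (g * h)%g)%:E.
  by apply: integral_ge0 => g _; rewrite lee_fin.
have mphi := measurable_integral_indic_mulr second_countableG P mA.
apply: le_trans (omega_dominates mphi phi0 (exprn_ge0 j s_ge0) _).
  rewrite exprS leeDl// mule_ge0// integral_ge0// => h _; exact: phi0.
move=> h Kh; rewrite integral_indic_mulr//; apply: le_trans IH _.
apply: le_measure; rewrite ?inE//; first exact: measurable_preimage_mulr.
by move=> g Kg /=; rewrite /A powsetSr; exact: mulsetP.
Qed.

(** The set A is allowed to spread from F to F K^k so that the induction on the
    number j of steps closes: a last step h in K turns A into A h^-1, which lies
    in F K^(k+1).  The sum k + j is preserved, hence bounded by M + 1, and when
    the last step is the one in E the bound leaves both K^j and K^k inside K^M.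
    At j = 0 the exponent j.-1 is truncated, but the factor j vanishes. *)
Lemma convolution_pow_lower_bound M j k (A : set (borel G)) :
  mulset (mulset (powset K M) F) (powset K M) `<=` E -> lambda E < +oo ->
  (k + j <= M.+1)%N -> measurable A -> A `<=` mulset F (powset K k) ->
  lambda A < +oo ->
  (j%:R * tau * s ^+ j.-1)%:E * lambda A <= convolution_pow omega j A.
Proof.
move=> KFK Eoo; elim: j k A => [|j IH] k A kjM mA AFK Aoo.
  by rewrite !mul0r mul0e measure_ge0.
have [P PE] := convolution_pow_probability second_countableG omega j.
have mE : measurable (E : set (borel G)) by exact: borel_compact.
have mKj : measurable (powset K j : set (borel G)).
  by apply: borel_compact => //; exact: compact_powset.
rewrite [convolution_pow _ _]/= PE /convolution.
have phi0 h : 0 <= \int[P]_g (\1_A (g * h)%g)%:E.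
  by apply: integral_ge0 => g _; rewrite lee_fin.
have mphi := measurable_integral_indic_mulr second_countableG P mA.
have lA : lambda A = (fine (lambda A))%:E.
  by rewrite fineK// ge0_fin_numE.
set a := fine (lambda A) in lA.
have a0 : (0 <= a)%R by exact: fine_ge0.
pose c := (j%:R * tau * s ^+ j.-1 * a)%R.
have c0 : (0 <= c)%R by rewrite !mulr_ge0// exprn_ge0.
(* The last step lies in K. *)
apply: le_trans (omega_dominates mphi phi0 c0 _); last first.
  move=> h Kh; rewrite integral_indic_mulr// -PE.
  have lAh : lambda ((fun g => (g * h)%g) @^-1` A) = lambda A.
    rewrite -[RHS](lambda_right (h^-1)%g mA); congr (lambda _).
    apply/seteqP; split => [g Agh|_ [x Ax [_ -> <-]]] /=; last by rewrite mulgVK.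
    by rewrite -[g](mulgK h); exact: mulsetP.
  rewrite /c EFinM -lA -lAh; apply: (IH k.+1).
  - by rewrite addSnnS.
  - exact: measurable_preimage_mulr.
  - move=> g /AFK [f Ff [p Kp fp]].
    rewrite -[g](mulgK h) -fp -mulgA; apply: mulsetP => //.
    by rewrite powsetSr; apply: mulsetP => //; exact: (symmetric_setP K).1.
  - by rewrite lAh.
(* The last step is uniform in E. *)
apply: (@le_trans _ _ ((s * c)%:E + tau%:E * (P (powset K j) * lambda A))); last first.
  rewrite leeD2l// lee_wpmul2l//.
  apply: integral_indic_mul_ge => // g Kg h /= /AFK [f Ff [p Kp fp]].
  have jM : (j <= M)%N by lia.
  have kM : (k <= M)%N by lia.
  have -> : h = (g^-1 * f * p)%g by rewrite -mulgA fp mulKg.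
  apply: KFK; apply: mulsetP; last exact: powset_le kM _ _.
  apply: mulsetP => //; apply: (powset_le oneK jM).
  exact: (symmetric_setP _).1 (symmetric_powset j symK) _ Kg.
have := convolution_pow_powset j; rewrite PE => sP.
apply: (@le_trans _ _ ((s * c)%:E + tau%:E * ((s ^+ j)%:E * lambda A))); last first.
  by rewrite leeD2l// lee_wpmul2l// lee_wpmul2r.
rewrite lA -!EFinM -EFinD lee_fin /c -natr1 /=.
case: j {IH kjM PE mKj c c0 sP} => [|j] /=; last by rewrite exprS; lra.
by rewrite expr0; lra.
Qed.

End random_walk_lower_bound.

(** * Mixtures of uniform laws *)

Section mixture.
Variables (R : realType) (G : topologicalGroupType).
Variable lambda : {measure set (borel G) -> \bar R}.
Local Open Scope ereal_scope.

Lemma eseries_from1 (f : nat -> \bar R) : (forall i, (1 <= i)%N -> 0 <= f i) ->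
  \sum_(1 <= i <oo) f i = \sum_(0 <= i <oo) f i.+1.
Proof.
move=> f0; pose g i := if i is _.+1 then f i else 0.
transitivity (\sum_(1 <= i <oo) g i).
  apply: congr_lim; apply/funext => n; apply: eq_big_nat => -[|i]//.
rewrite -nneseries_addn; last by move=> [|i]//; exact: f0.
by apply: congr_lim; apply/funext => n; apply: eq_big_nat => i _; rewrite addn1.
Qed.

Variables (E : nat -> set G) (t : nat -> R) (omega : probability (borel G) R).
Hypotheses (mE : forall k, (1 <= k)%N -> measurable (E k : set (borel G)))
  (E_gt0 : forall k, (1 <= k)%N -> 0 < lambda (E k))
  (E_fin : forall k, (1 <= k)%N -> lambda (E k) < +oo)
  (t_ge0 : forall k, (1 <= k)%N -> (0 <= t k)%R)
  (omega_density : has_density lambda omega (fun x =>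
     (\sum_(1 <= n <oo) (t n * (\1_(E n) x / fine (lambda (E n))))%:E)%E)).

Local Notation w k := (t k.+1 / fine (lambda (E k.+1)))%R.

Let w_ge0 k : (0 <= w k)%R.
Proof. by rewrite divr_ge0 ?t_ge0// fine_ge0. Qed.

(** The density identifies omega with a countable sum of multiples of
    restrictions of lambda, against which integration is termwise. *)
Lemma integral_mixture (phi : borel G -> \bar R) :
  measurable_fun setT phi -> (forall x, 0 <= phi x) ->
  \int[omega]_x phi x =
  \sum_(0 <= k <oo) (w k)%:E * \int[lambda]_(x in E k.+1) phi x.
Proof.
move=> mphi phi0.
pose m k := mscale (NngNum (w_ge0 k)) (mrestr lambda (mE (ltn0Sn k))).
have -> : \int[omega]_x phi x = \int[mseries m 0]_x phi x.
  apply: eq_measure_integral => A mA _.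
  have [_ _ omegaE] := omega_density; rewrite [LHS]omegaE//.
  transitivity (\int[lambda]_(x in A)
      \sum_(0 <= k <oo) (w k * \1_(E k.+1) x)%:E).
    apply: eq_integral => x _; rewrite eseries_from1.
      apply: congr_lim; apply/funext => n; apply: eq_bigr => k _.
      by congr EFin; rewrite mulrA mulrAC.
    by move=> i i1; rewrite lee_fin mulr_ge0 ?t_ge0// divr_ge0 ?fine_ge0.
  rewrite integral_nneseries//.
  - apply: congr_lim; apply/funext => n; apply: eq_bigr => k _.
    rewrite (integralZl_indic mA (fun=> E k.+1))//; last 2 first.
    + by move=> /lt_geF; rewrite w_ge0.
    + exact: mE.
    rewrite integral_indic //=; last exact: mE.
    by rewrite setIC.
  - move=> k; apply/measurable_EFinP; apply: measurable_funM => //.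
    by apply: measurable_indic; exact: mE.
  - by move=> k x _; rewrite lee_fin mulr_ge0.
rewrite ge0_integral_measure_series//.
apply: congr_lim; apply/funext => n; apply: eq_bigr => k _.
by rewrite /m ge0_integral_mscale//= ge0_integral_mrestr.
Qed.

(** Only the first n + 1 terms of the mixture are kept: the first n are carried
    by E n, and the last one is uniform on E n.+1. *)
Lemma mixture_dominates n : (forall k, (1 <= k <= n)%N -> E k `<=` E n) ->
  step_dominates lambda omega (E n) (\sum_(0 <= k < n) t k.+1) (E n.+1)
    (t n.+1 / fine (lambda (E n.+1))).
Proof.
move=> EE phi c mphi phi0 c0 cphi; rewrite integral_mixture//.
have term0 k : 0 <= (w k)%:E * \int[lambda]_(x in E k.+1) phi x.
  by rewrite mule_ge0 ?lee_fin// integral_ge0// => x _; exact: phi0.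
apply: le_trans (nneseries_lim_ge n.+1 _) => //.
rewrite big_nat_recr//= leeD2r// mulr_suml -sumEFin [leLHS]big_nat [leRHS]big_nat.
apply: lee_sum => k /andP[_ kn].
have L0 : (0 < fine (lambda (E k.+1)))%R.
  by rewrite fine_gt0// E_gt0//= E_fin.
have -> : (t k.+1 * c)%:E = (w k)%:E * (c%:E * lambda (E k.+1)).
  rewrite -[lambda _]fineK ?ge0_fin_numE ?E_fin// -!EFinM; congr EFin.
  by rewrite mulrCA divfK ?gt_eqF// mulrC.
rewrite lee_wpmul2l ?lee_fin// -integral_cst; last exact: mE.
apply: ge0_le_integral => //=.
- exact: mE.
- exact: measurable_funTS.
- by move=> x Ex; apply: cphi; apply: (EE k.+1).
Qed.

End mixture.

(** * From measures of sets to densities *)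

Section density_lower_bound.
Context d (T : measurableType d) (R : realType).
Variable lambda : {measure set T -> \bar R}.
Local Open Scope ereal_scope.

(** On the part of D where f <= c - e, the density integrates to at most
    (c - e) lambda, so this part is null.  Removing first the null set that
    carries the singular part of nu lets nu be compared with its absolutely
    continuous part alone. *)
Lemma is_rn_derivative_ge (nu : set T -> \bar R) (f : T -> \bar R) (D : set T) (c : R) :
  measurable D -> lambda D < +oo -> is_rn_derivative lambda nu f ->
  (forall A, measurable A -> A `<=` D -> c%:E * lambda A <= nu A) ->
  {ae lambda, forall x, D x -> c%:E <= f x}.
Proof.
move=> mD Doo [nua [nus [nuE [mf f0 nuaE] [S [mS lS nuS]]]]] nu_ge.
have small (e : R) : (0 < e)%R -> {ae lambda, forall x, D x -> (c - e)%:E < f x}.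
  move=> e0; pose A := D `&` [set x | f x <= (c - e)%:E].
  have mA : measurable A by apply: emeasurable_fun_infty_c => //; exact: measurable_funTS.
  pose B := A `\` S; have mB : measurable B by exact: measurableD.
  exists A; split => //; last first.
    by move=> x /= /not_implyP[Dx /negP]; rewrite -leNgt; split.
  have nusB : nus B = 0.
    apply: (subset_measure0 mB _ _ nuS); first exact: measurableC.
    by move=> x [].
  have lB : lambda B < +oo.
    by apply: le_lt_trans Doo; apply: le_measure; rewrite ?inE// => x [[]].
  have : c%:E * lambda B <= (c - e)%:E * lambda B.
    apply: le_trans (nu_ge B mB _) _; first by move=> x [[]].
    rewrite nuE// nusB adde0 nuaE// -integral_cst//; apply: ge0_le_integral => //.
    - exact: measurable_funTS.
    - by move=> x [[]].
  have lBE : lambda B = (fine (lambda B))%:E by rewrite fineK// ge0_fin_numE.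
  have b0 : (0 <= fine (lambda B))%R by exact: fine_ge0.
  set b := fine (lambda B) in lBE b0.
  rewrite lBE -!EFinM lee_fin mulrBl lerDl oppr_ge0 => ub.
  have lB0 : lambda B = 0.
    rewrite lBE; congr EFin; apply/eqP; rewrite eq_le b0 andbT.
    by rewrite -(pmulr_rle0 _ e0).
  apply/eqP; rewrite -measure_le0 -lB0 -[leRHS]adde0 -lS.
  apply: le_trans (measureU2 _ _ _) => //.
  apply: le_measure; rewrite ?inE//; first exact: measurableU.
  by move=> x Ax; have [Sx|nSx] := pselect (S x); [right|left; split].
have : {ae lambda, forall x, forall k : nat, D x -> (c - k.+1%:R^-1)%:E < f x}.
  by apply: ae_foralln => k; apply: small; rewrite invr_gt0.
apply: filterS => x xk Dx; rewrite leNgt; apply/negP => fxc.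
have := f0 x; case: (f x) fxc xk => [r| |]//= rc xk _.
rewrite lte_fin in rc.
have [k ck] := ltr_add_invr rc.
by have := xk k Dx; rewrite lte_fin ltrBlDr ltNge (ltW ck).
Qed.
End density_lower_bound.

(** * Asymptotics of the weights *)

Section liminf.
Variable R : realType.
Local Open Scope ereal_scope.
Implicit Types u v : (\bar R)^nat.

Lemma limn_einfZl_le (c : R) u v : (0 < c)%R ->
  (\forall n \near \oo, c%:E * u n <= v n) ->
  c%:E * limn_einf u <= limn_einf v.
Proof.
move=> c0 uv; rewrite !limn_einf_lim -limeMl//; last exact: is_cvg_einfs.
apply: lee_lim; [exact/is_cvgeMl/is_cvg_einfs|exact: is_cvg_einfs|].
case: uv => N _ uv; exists N => // n /= Nn.
apply/ereal_infP => _ [k /= nk <-].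
apply: le_trans (uv k (leq_trans Nn nk)); apply: lee_wpmul2l; first by rewrite lee_fin ltW.
by apply: ereal_inf_lbound; exists k.
Qed.
End liminf.

Section asymptotics.
Variable R : realType.
Local Open Scope ring_scope.

(** Multiplied by expR (2 * x) >= 1 + 2 * x, the claim reduces to
    1 <= (1 - x) * (1 + 2 * x), that is x * (1 - 2 * x) >= 0. *)
Lemma expR_opp_le1B (x : R) : 0 <= x <= 2^-1 -> expR (- (2 * x)) <= 1 - x.
Proof.
move=> /andP[x0 x1]; rewrite expRN -[leRHS]invrK.
have x1' : 0 < 1 - x by lra.
rewrite lef_pV2 ?posrE ?expR_gt0 ?invr_gt0//.
apply: le_trans (expR_ge1Dx _); rewrite -[leLHS]mul1r ler_pdivrMr//.
by nra.
Qed.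

(** Every power is at least (1 - x) ^+ N >= expR (- 2 x N), and the remaining
    sum N (N - 1) / 2 is at least N ^ 2 / 4 because N >= 2. *)
Lemma sum_mul_expn_ge (N : nat) (x : R) : (2 <= N)%N -> 0 <= x <= 2^-1 ->
  N%:R ^+ 2 / 4 * expR (- (2 * (x * N%:R))) <=
  \sum_(0 <= j < N) j%:R * (1 - x) ^+ j.-1.
Proof.
move=> N2 x01; have /andP[x0 x1] := x01.
have pw j : (j < N)%N -> expR (- (2 * (x * N%:R))) <= (1 - x) ^+ j.-1.
  move=> jN; rewrite mulrA -mulNr mulrC expRM_natl.
  apply: (@le_trans _ _ ((1 - x) ^+ N)).
    by rewrite lerXn2r ?nnegrE ?expR_ge0 ?expR_opp_le1B//; lra.
  by apply: ler_wiXn2l; [lra|lra|rewrite (leq_trans (leq_pred j) (ltnW jN))].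
apply: (@le_trans _ _ (\sum_(0 <= j < N) j%:R * expR (- (2 * (x * N%:R))))); last first.
  by rewrite big_nat [leRHS]big_nat; apply: ler_sum => j /andP[_ jN]; rewrite ler_wpM2l// pw.
have sumE n : \sum_(0 <= j < n) j%:R = n%:R * (n%:R - 1) / 2 :> R.
  elim: n => [|n IH]; first by rewrite big_nil mul0r mul0r.
  by rewrite big_nat_recr//= IH -natr1; field.
rewrite -mulr_suml ler_wpM2r ?expR_ge0// sumE.
have : 2 <= N%:R :> R by rewrite ler_nat.
nra.
Qed.

Lemma near_tail_le (t r : nat -> R) (e : R) : 0 < e ->
  (forall n, (1 <= n)%N -> 0 <= t n) ->
  (\sum_(1 <= n <oo) (t n)%:E < +oo)%E ->
  (forall n, (1 <= n)%N -> ((r n)%:E = \sum_(n <= j <oo) (t j)%:E)%E) ->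
  \forall n \near \oo, r n <= e.
Proof.
move=> e0 t0 sumt rE; pose f n : \bar R := if n is _.+1 then (t n)%:E else 0%E.
have f0 n : (0 <= f n)%E by case: n => //= n; rewrite lee_fin t0.
have fE n : (1 <= n)%N -> (\sum_(n <= j <oo) f j = \sum_(n <= j <oo) (t j)%:E)%E.
  move=> n1; apply: congr_lim; apply/funext => m; apply: eq_big_nat => -[|j]//.
  by move=> /andP[/(leq_trans n1)].
have /fine_cvg /cvgrPdist_le /(_ e e0) : (\sum_(n <= j <oo) f j @[n --> \oo] --> 0%:E)%E.
  apply: (@nneseries_tail_cvg _ f xpredT) => //.
  by rewrite (@nneseries_split _ f 0 1)// big_nat1 add0e fE.
move=> [n0 _ small]; exists n0.+1 => // n /= n0n.
have /= := small n (ltnW n0n); rewrite fE ?(leq_ltn_trans _ n0n)// -rE ?(leq_ltn_trans _ n0n)//=.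
by rewrite sub0r normrN; exact/le_trans/ler_norm.
Qed.

(** The product t n * N n tends to (1 - q) c, so it is eventually at least half
    of this limit, and r n * N n is eventually at most 2 c; the constant is what
    these two bounds give in [sum_mul_expn_ge]. *)
Lemma escape_weight_ge (t r : nat -> R) (N : nat -> nat) (c q : R) :
  0 < c -> q < 1 ->
  (forall n, (1 <= n)%N -> t n = r n - r n.+1) ->
  (forall n, (1 <= n)%N -> 0 < r n) ->
  (forall n, (2 <= n)%N -> (2 <= N n)%N) ->
  (\forall n \near \oo, r n <= 2^-1) ->
  (fun n => r n * (N n)%:R) @ \oo --> c ->
  (fun n => r n.+1 / r n) @ \oo --> q ->
  \forall n \near \oo, (1 - q) * c / 8 * expR (- (4 * c)) <=
    t n / (N n)%:R * \sum_(0 <= j < N n) j%:R * (1 - r n) ^+ j.-1.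
Proof.
move=> c0 q1 tE r0 N2 rsmall rN rr.
have tN : (fun n => (1 - r n.+1 / r n) * (r n * (N n)%:R)) @ \oo --> (1 - q) * c.
  by apply: cvgM => //; apply: cvgB => //; exact: cvg_cst.
have qc0 : 0 < (1 - q) * c by rewrite mulr_gt0// subr_gt0.
have rN2 : \forall n \near \oo, r n * (N n)%:R <= 2 * c.
  by apply: (cvgr_le _ rN); lra.
have tN2 : \forall n \near \oo, (1 - q) * c / 2 <= (1 - r n.+1 / r n) * (r n * (N n)%:R).
  by apply: (cvgr_ge _ tN); lra.
near=> n.
have n2 : (2 <= n)%N by near: n; exists 2.
have n1 : (1 <= n)%N by exact: ltnW.
have rn : r n <= 2^-1 by near: n.
have rNn : r n * (N n)%:R <= 2 * c by near: n.
have tNn : (1 - q) * c / 2 <= t n * (N n)%:R.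
  have : (1 - q) * c / 2 <= (1 - r n.+1 / r n) * (r n * (N n)%:R) by near: n.
  rewrite (_ : (1 - _ / _) * _ = t n * (N n)%:R)// tE//.
  by field; rewrite gt_eqF ?r0.
have N0 : 0 < (N n)%:R :> R by rewrite ltr0n (leq_trans _ (N2 n n2)).
have tN0 : 0 < t n * (N n)%:R by apply: lt_le_trans tNn; lra.
have t0 : 0 < t n by rewrite -(pmulr_lgt0 _ N0).
have := @sum_mul_expn_ge (N n) (r n) (N2 n n2).
rewrite (ltW (r0 n n1)) rn => /(_ isT) sum_ge.
apply: (@le_trans _ _ (t n / (N n)%:R *
    ((N n)%:R ^+ 2 / 4 * expR (- (2 * (r n * (N n)%:R)))))); last first.
  by rewrite ler_wpM2l// divr_ge0// ltW.
have -> : t n / (N n)%:R * ((N n)%:R ^+ 2 / 4 * expR (- (2 * (r n * (N n)%:R)))) =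
    t n * (N n)%:R / 4 * expR (- (2 * (r n * (N n)%:R))).
  by field; rewrite gt_eqF.
apply: ler_pM; rewrite ?expR_ge0//; [lra|lra|].
by rewrite ler_expR; lra.
Unshelve. all: by end_near. Qed.

End asymptotics.

(** * The sets E_n *)

Section tower.
Variables (G : topologicalGroupType) (F E : nat -> set G) (N : nat -> nat).
Hypotheses
  (symF : forall n, (1 <= n)%N -> symmetric_set (F n))
  (compactF : forall n, (1 <= n)%N -> compact (F n))
  (oneF : forall n, (1 <= n)%N -> F n 1%g)
  (N_gt2 : forall n, (2 <= n)%N -> (2 < N n)%N)
  (E1 : E 1%N = F 1%N)
  (En : forall n, (2 <= n)%N ->
     E n = mulset (mulset (invset (powset (E n.-1) (N n - 2))) (F n))
                  (invset (powset (E n.-1) (N n - 2)))).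

Lemma tower_compact_symmetric_one n : (1 <= n)%N ->
  [/\ compact (E n), symmetric_set (E n) & E n 1%g].
Proof.
elim: n => // -[_ _|n IH _]; first by rewrite E1; split; [exact: compactF|exact: symF|exact: oneF].
have [cE sE oE] := IH isT.
have sP := symmetric_powset (N n.+2 - 2) sE.
rewrite En//= -sP; split.
- apply: compact_mulset; [apply: compact_mulset|]; [exact: compact_powset|exact: compactF|exact: compact_powset].
- by rewrite /symmetric_set !invset_mulset -sP -symF// mulsetA.
- have P1 := powset1 (N n.+2 - 2) oE.
  by rewrite -[1%g]mulg1; apply: mulsetP => //; rewrite -[1%g]mulg1; apply: mulsetP => //; exact: oneF.
Qed.

(** Since E n is symmetric, so are its powers, and the inverses in the recursion
    disappear. *)
Lemma towerS n : (1 <= n)%N ->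
  E n.+1 = mulset (mulset (powset (E n) (N n.+1 - 2)) (F n.+1))
                  (powset (E n) (N n.+1 - 2)).
Proof.
move=> n1; have [_ sE _] := tower_compact_symmetric_one n1.
by rewrite En//= -(symmetric_powset _ sE).
Qed.

Lemma tower_F n : (1 <= n)%N -> F n `<=` E n.
Proof.
case: n => // -[_|n _]; first by rewrite E1.
have [_ _ /powset1 oP] := @tower_compact_symmetric_one n.+1 isT.
move=> x Fx; rewrite towerS// -[x]mulg1; apply: mulsetP => //.
by rewrite -[x]mul1g; exact: mulsetP.
Qed.

Lemma tower_nested m n : (1 <= m <= n)%N -> E m `<=` E n.
Proof.
elim: n => [|n IH]; first by case: m.
move=> /andP[m1]; rewrite leq_eqVlt => /predU1P[->//|mn].
apply: subset_trans (IH _) _; first by rewrite m1.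
have n1 : (1 <= n)%N by exact: leq_trans m1 mn.
have [_ _ oE] := tower_compact_symmetric_one n1.
move=> x Ex; rewrite towerS// -[x]mulg1; apply: mulsetP; last exact: powset1.
rewrite -[x]mulg1; apply: mulsetP; last exact: oneF.
apply: (@powset_le _ _ 1) => //; first by rewrite subn_gt0 N_gt2.
by rewrite /= mulsetg1.
Qed.

End tower.

(** * Lower bound for the averages *)

(* Sequences indexed by the positive integers are functions on nat whose
   value at 0 is irrelevant. *)
Theorem proposition3p7 (R : realType) (G : topologicalGroupType)
  (lambda : {measure set (borel G) -> \bar R})
  (F E : nat -> set G) (N : nat -> nat) (t r : nat -> R)
  (omega : probability (borel G) R)
  (hausdorffG : hausdorff_space G)
  (locally_compactG : locally_compact [set: G])
  (second_countableG : @second_countable G)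
  (unimodularG : unimodular R G)
  (haar_lambda : haar_measure lambda)
  (symF : forall n, (1 <= n)%N -> symmetric_set (F n))
  (compactF : forall n, (1 <= n)%N -> compact (F n))
  (posF : forall n, (1 <= n)%N -> (0 < lambda (F n))%E)
  (oneF : forall n, (1 <= n)%N -> F n 1%g)
  (posN : forall n, (1 <= n)%N -> (1 <= N n)%N)
  (increasingN : forall m n, (1 <= m <= n)%N -> (N m <= N n)%N)
  (N2 : (2 < N 2)%N)
  (E1 : E 1%N = F 1%N)
  (En : forall n, (2 <= n)%N ->
     E n = mulset (mulset (invset (powset (E n.-1) (N n - 2))) (F n))
                  (invset (powset (E n.-1) (N n - 2))))
  (t01 : forall n, (1 <= n)%N -> 0 < t n < 1)
  (sum_t : (\sum_(1 <= n <oo) (t n)%:E = 1)%E)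
  (omega_density : has_density lambda omega (fun x =>
     (\sum_(1 <= n <oo) (t n * (\1_(E n) x / fine (lambda (E n))))%:E)%E))
  (r_def : forall n, (1 <= n)%N -> ((r n)%:E = \sum_(n <= j <oo) (t j)%:E)%E)
  (lim_rN : exists2 c : R, 0 < c & (fun n => r n * (N n)%:R) @ \oo --> c)
  (lim_rr : exists2 q : R, 0 < q < 1 & (fun n => r n.+1 / r n) @ \oo --> q) :
  exists C' : R, 0 < C' /\
    forall f : nat -> G -> \bar R,
      (forall j, is_rn_derivative lambda (convolution_pow omega j) (f j)) ->
      {ae lambda, forall x : G,
        (limn_einf (fun n => (fine (lambda (F n)) / (N n)%:R)%:E *
                             \sum_(0 <= j < N n) f j x)
         >= C'%:E *
            limn_einf (fun n => (fine (lambda (F n)) / fine (lambda (E n)) *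
                                 \1_(F n) x)%:E))%E}.
Proof.
have [_ [lam_compact _ _] lam_left] := haar_lambda.
have lam_right := unimodularG _ haar_lambda.
have N_gt2 n : (2 <= n)%N -> (2 < N n)%N.
  by move=> n2; apply: (leq_trans N2); exact: increasingN.
have E_basic := tower_compact_symmetric_one symF compactF oneF E1 En.
have F_sub_E := tower_F symF compactF oneF E1 En.
have E_nested := tower_nested symF compactF oneF N_gt2 E1 En.
have mE k : (1 <= k)%N -> measurable (E k : set (borel G)).
  by move=> /E_basic[cE _ _]; exact: borel_compact.
have mF k : (1 <= k)%N -> measurable (F k : set (borel G)).
  by move=> k1; apply: borel_compact => //; exact: compactF.
have E_fin k : (1 <= k)%N -> (lambda (E k) < +oo)%E.
  by move=> /E_basic[cE _ _]; exact: lam_compact.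
have E_gt0 k : (1 <= k)%N -> (0 < lambda (E k))%E.
  move=> k1; apply: lt_le_trans (posF k k1) _.
  by apply: le_measure; rewrite ?inE; [exact: mF|exact: mE|exact: F_sub_E].
have t_ge0 k : (1 <= k)%N -> 0 <= t k by move=> /t01/andP[/ltW].
have tr n : (1 <= n)%N -> t n = r n - r n.+1.
  move=> n1; apply/eqP; rewrite eq_sym subr_eq; apply/eqP; apply: EFin_inj.
  rewrite EFinD r_def// (@nneseries_split _ _ _ 1); last first.
    by move=> k nk; rewrite lee_fin t_ge0// (leq_trans n1).
  by rewrite addn1 big_nat1 -r_def.
have r_gt0 n : (1 <= n)%N -> 0 < r n.
  move=> n1; have /andP[tn _] := t01 n n1.
  apply: lt_le_trans tn _; rewrite tr// gerBl -lee_fin r_def//.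
  apply: nneseries_ge0 => k nk _; rewrite lee_fin t_ge0//; exact: leq_trans nk.
have r1 : r 1%N = 1 by apply: EFin_inj; rewrite r_def.
have partial_t n : \sum_(0 <= k < n) t k.+1 = 1 - r n.+1.
  elim: n => [|n IH]; first by rewrite big_nil r1 subrr.
  by rewrite big_nat_recr//= IH tr//; lra.
have [c c0 rN] := lim_rN; have [q /andP[_ q1] rr] := lim_rr.
exists ((1 - q) * c / 8 * expR (- (4 * c))); split.
  by rewrite !mulr_gt0 ?subr_gt0 ?expR_gt0.
move=> f f_rn.
have f_ge0 j x : (0 <= f j x)%E by have [? [? [_ [_ + _] _]]] := f_rn j; apply.
pose tau n := t n / fine (lambda (E n)).
have walk_ge : {ae lambda, forall x n j, (2 <= n)%N -> (j < N n)%N -> F n x ->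
    ((j%:R * tau n * (1 - r n) ^+ j.-1)%:E <= f j x)%E}.
  apply: ae_foralln => n; apply: ae_foralln => j.
  have [n2|?] := leqP 2 n; last by apply: aeW => x.
  have [jN|?] := ltnP j (N n); last by apply: aeW => x.
  case: n n2 jN => // n n1 jN; have [cE sE oE] := E_basic n n1.
  suff : {ae lambda, forall x, F n.+1 x ->
      ((j%:R * tau n.+1 * (1 - r n.+1) ^+ j.-1)%:E <= f j x)%E}.
    by apply: (@filterS _ _ (ae_filter_ringOfSetsType lambda)) => x Fx _ _; exact: Fx.
  apply: (@is_rn_derivative_ge _ _ _ _ (convolution_pow omega j)) => //.
  - exact: mF.
  - by apply: lam_compact; exact: compactF.
  move=> A mA AF.
  have Ech : step_dominates lambda omega (E n) (1 - r n.+1) (E n.+1) (tau n.+1).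
    by rewrite -partial_t; apply: mixture_dominates => // k kn; exact: E_nested.
  have [cE' _ _] := E_basic n.+1 isT.
  apply: (convolution_pow_lower_bound hausdorffG second_countableG lam_left
    lam_right cE cE' sE oE _ _ Ech (F := F n.+1) (M := N n.+1 - 2) (k := 0)) => //.
  - by rewrite -partial_t; apply: sumr_ge0 => k _; exact: t_ge0.
  - by rewrite divr_ge0 ?t_ge0// fine_ge0.
  - by rewrite (towerS symF compactF oneF E1 En).
  - exact: E_fin.
  - by move: jN; lia.
  - by rewrite /= mulsetg1.
  - apply: le_lt_trans (lam_compact _ (compactF n.+1 isT)).
    by apply: le_measure; rewrite ?inE//; exact: mF.
have weight_ge : \forall n \near \oo, (1 - q) * c / 8 * expR (- (4 * c)) <=
    t n / (N n)%:R * \sum_(0 <= j < N n) j%:R * (1 - r n) ^+ j.-1.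
  apply: escape_weight_ge => //; first by move=> n /N_gt2/ltnW.
  by apply: (@near_tail_le _ t) => //; rewrite ?sum_t ?ltry// invr_gt0.
move: walk_ge; apply: (@filterS _ _ (ae_filter_ringOfSetsType lambda)) => x walk_ge.
apply: limn_einfZl_le.
  by rewrite !mulr_gt0 ?subr_gt0 ?expR_gt0.
near=> n.
have n2 : (2 <= n)%N by near: n; exists 2.
have n1 : (1 <= n)%N by exact: ltnW.
(* Off F n the lower bound vanishes. *)
have [Fx|nFx] := pselect (F n x); last first.
  rewrite indicE memNset// mulr0 mule0 mule_ge0//.
  by apply: sume_ge0 => j _; exact: f_ge0.
apply: (@le_trans _ _ ((fine (lambda (F n)) / (N n)%:R)%:E *
    \sum_(0 <= j < N n) (j%:R * tau n * (1 - r n) ^+ j.-1)%:E)%E); last first.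
  rewrite lee_wpmul2l ?lee_fin ?divr_ge0 ?fine_ge0//.
  by rewrite [leLHS]big_nat [leRHS]big_nat; apply: lee_sum => j /andP[_ jN]; exact: walk_ge.
rewrite sumEFin -!EFinM lee_fin indicE mem_set// mulr1.
have -> : \sum_(0 <= j < N n) j%:R * tau n * (1 - r n) ^+ j.-1 =
    tau n * \sum_(0 <= j < N n) j%:R * (1 - r n) ^+ j.-1.
  by rewrite mulr_sumr; apply: eq_bigr => j _; ring.
rewrite /tau.
have L0 : 0 <= fine (lambda (F n)) / fine (lambda (E n)).
  by rewrite divr_ge0 ?fine_ge0.
apply: (@le_trans _ _ (t n / (N n)%:R * (\sum_(0 <= j < N n) j%:R * (1 - r n) ^+ j.-1) *
    (fine (lambda (F n)) / fine (lambda (E n))))).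
  by rewrite ler_wpM2r//; near: n.
by rewrite le_eqVlt; apply/orP; left; apply/eqP; ring.
Unshelve. all: by end_near. Qed.
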